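(* If $n=2m$ is even ($m\ge1$), then the class function $-n!\,\omega_n$ on $S_n$ is the character of the induced representation $$\rho_{2m}^{-}:=\mathrm{Ind}_{C_{2m}}^{S_{2m}}(\chi_{\mathrm{sgn}})$$ from the cyclic group $C_{2m}$ generated by a $2m$-cycle in $S_{2m}$, carrying on it the (restriction of the) sign representation $\chi_{\mathrm{sgn}}$. The representation $\rho_{2m}^{-}$ is of degree $(2m-1)!$ and is reducible for $m\ge2$. The trivial representation $\chi_{\mathrm{triv}}$ of $S_{2m}$ occurs in $\rho_{2m}^{-}$ with multiplicity $0$ and the sign representation $\chi_{\mathrm{sgn}}$ occurs with multiplicity $1$.
   Context: Representations are over $\mathbb{C}$. A partition $\lambda\vdash n$ is written $[n^{m_n},\dots,2^{m_2},1^{m_1}]$, where $m_j=m_j(\lambda)$ is the number of parts equal to $j$. $C_\lambda\subset S_n$ is the conjugacy class of permutations of cycle type $\lambda$. For a function $f$ on $S_n$ and $Y\subseteq S_n$, $f(Y):=\sum_{g\in Y}f(g)$ (so for a class function $f(g)=f(C_\lambda)/|C_\lambda|$ when $g\in C_\lambda$). The $m$-th necklace polynomial is $M_m(X)=\frac1m\sum_{d\mid m}\mu(d)X^{m/d}$. The cycle polynomial of $\lambda\vdash n$ is $N_\lambda(X)=\prod_{j=1}^n\binom{M_j(X)}{m_j(\lambda)}$, where $\binom{t}{k}=\frac{t(t-1)\cdots(t-k+1)}{k!}$. For $n\ge 2$ every $N_\lambda(X)$ is divisible by $X-1$, and the $1$-splitting measure on $S_n$ is the class function with $\nu_{n,1}^{\ast}(C_\lambda)=\left.\frac{N_\lambda(X)}{X^{n-1}(X-1)}\right|_{X=1}$.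 The measures $\omega_n$ on $S_n$ ($n\ge1$) are the class functions defined recursively by $\omega_1(C_{[1]})=1$ and, for $n\ge2$: $\omega_n(C_\lambda)=\nu_{n,1}^{\ast}(C_\lambda)$ if $\lambda=[b^a]$ with $ab=n$ and $b>1$; $\omega_n(C_{[1^n]})=\nu_{n,1}^{\ast}(C_{[1^n]})-\omega_{n-1}(C_{[1^{n-1}]})$; and $\omega_n(C_\lambda)=0$ for all other $\lambda$. *)

(* Defs.v *)
From HB Require Import structures.
From mathcomp Require Import all_boot all_order all_algebra all_fingroup.
From mathcomp Require Import all_solvable all_field all_character.
Set Implicit Arguments.
Unset Strict Implicit.
Unset Printing Implicit Defensive.
Import GroupScope GRing.Theory Num.Theory.
Local Open Scope ring_scope.

(* A partition of n is represented by the nonincreasing sequence of its parts, *)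
(* so that m_j(lam) is [count_mem j lam] and [b^a] is [nseq a b].              *)

Definition cycle_type (T : finType) (s : {perm T}) : seq nat :=
  sort geq [seq #|pred_of_set X| | X <- enum (porbits s)].

Definition cycle_class (n : nat) (lam : seq nat) : {set 'S_n} :=
  [set s : 'S_n | cycle_type s == lam].

Definition moebius (d : nat) : int :=
  if all (fun pe : nat * nat => pe.2 == 1%N) (prime_decomp d)
  then (-1) ^+ size (primes d) else 0.

Definition necklace_poly (m : nat) : {poly rat} :=
  (m%:R)^-1 *: \sum_(d <- divisors m) (moebius d)%:~R *: 'X^(m %/ d).

Definition binomial_poly (p : {poly rat}) (k : nat) : {poly rat} :=
  ((k`!)%:R)^-1 *: \prod_(i < k) (p - i%:R).

Definition cycle_poly (n : nat) (lam : seq nat) : {poly rat} :=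
  \prod_(1 <= j < n.+1) binomial_poly (necklace_poly j) (count_mem j lam).

(* For n >= 2 the division by X - 1 is exact.  X^(n-1) need not divide N_lam   *)
(* (the quotient is only a Laurent polynomial), so it is evaluated separately. *)
Definition splitting_measure1 (n : nat) (lam : seq nat) : rat :=
  (cycle_poly n lam %/ ('X - 1)).[1] / ('X^(n.-1)).[1].

Definition is_rectangular (n : nat) (lam : seq nat) : bool :=
  [exists a : 'I_n.+1, exists b : 'I_n.+1,
    [&& (a * b == n)%N, (1 < b)%N & lam == nseq a (b : nat)]].

(* [omega n lam] is the total mass omega_n(C_lam) of the class C_lam, for lam  *)
(* a partition of n >= 1; the value at n = 0 is junk.                          *)
Fixpoint omega (n : nat) (lam : seq nat) {struct n} : rat :=
  match n with
  | 0 => 0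
  | 1 => (lam == [:: 1%N])%:R
  | n'.+1 =>
      if lam == nseq n 1%N then splitting_measure1 n lam - omega n' (nseq n' 1%N)
      else if is_rectangular n lam then splitting_measure1 n lam
      else 0
  end.

Lemma cycle_typeJ (T : finType) (s t : {perm T}) :
  cycle_type (s ^ t)%g = cycle_type s.
Proof.
have porbJ x : porbit (s ^ t)%g (t x) = t @: porbit s x.
  apply/setP=> y; apply/porbitP/imsetP => [[i ->] | [z /porbitP[i ->] ->]].
    by exists ((s ^+ i)%g x); rewrite ?mem_porbit // -conjXg permJ.
  by exists i; rewrite -conjXg permJ.
have injt : injective (fun X : {set T} => t @: X) := imset_inj (@perm_inj _ t).
have -> : cycle_type (s ^ t)%g
    = sort geq [seq #|pred_of_set X| | X <- [seq t @: X | X : {set T} <- enum (porbits s)]].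
  apply/perm_sortP; first exact: (fun m n => leq_total n m).
  - by move=> n m p /= le_nm le_pn; exact: leq_trans le_pn le_nm.
  - by move=> m n; rewrite /= andbC => /anti_leq.
  apply/perm_map/uniq_perm; rewrite ?(map_inj_uniq injt) ?enum_uniq // => X.
  rewrite mem_enum; apply/imsetP/mapP => [[x _ ->] | [Y]].
    exists (porbit s (t^-1 x)%g); first by rewrite mem_enum imset_f.
    by rewrite -porbJ permKV.
  by rewrite mem_enum => /imsetP[x _ ->] ->; exists (t x); rewrite ?porbJ.
rewrite /cycle_type -map_comp; congr (sort _ _).
by apply: eq_map => X /=; rewrite card_imset //; apply: perm_inj.
Qed.

Fact omega_cfun_subproof (n : nat) :
  is_class_fun <<[set: 'S_n]>>
    [ffun s : 'S_n => ratr (omega n (cycle_type s))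
                      / #|cycle_class n (cycle_type s)|%:R].
Proof.
rewrite genGid; apply: intro_class_fun => [s t _ _ | s].
  by rewrite cycle_typeJ.
by rewrite in_setT.
Qed.

(* A class function f takes the value f(C_lam) / |C_lam| on C_lam.             *)
Definition omega_cfun (n : nat) : 'CF([set: 'S_n]) :=
  Cfun 0 (omega_cfun_subproof n).

Section InducedRepresentation.

Variables (F : fieldType) (gT : finGroupType) (H G : {group gT}).
Hypothesis sHG : H \subset G.
Variables (d : nat) (W : mx_representation F H d).

Definition ind_transversal (i : 'I_#|rcosets H G|) : gT := repr (enum_val i).
Local Notation t := ind_transversal.

(* Matrices act on row vectors, so W (x) F[G] is the sum of the spaces W t_i,  *)
(* where the t_i represent the right cosets H t_i, and g maps W t_i to W t_j   *)
(* through W(t_i g t_j^-1) when H t_i g = H t_j.                               *)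
Definition ind_mx (g : gT) : 'M[F]_(\sum_(i < #|rcosets H G|) d) :=
  \mxblock_(i, j) (if (t i * g * (t j)^-1)%g \in H
                   then W (t i * g * (t j)^-1)%g else 0).

Let tG i : t i \in G.
Proof.
rewrite /t; have /rcosetsP[x Gx ->] := enum_valP i.
have [h Hh] := repr_rcosetP H x; by rewrite groupM // (subsetP sHG).
Qed.

Let tE i : enum_val i = (H :* t i)%g.
Proof.
by rewrite /t; have /rcosetsP[x Gx ->] := enum_valP i; rewrite rcoset_repr.
Qed.

Let t_ex g : g \in G -> exists j, (g * (t j)^-1)%g \in H.
Proof.
move=> Gg; have Cg : (H :* g)%g \in rcosets H G by apply/rcosetsP; exists g.
exists (enum_rank_in Cg (H :* g)%g).
by rewrite -mem_rcoset -tE enum_rankK_in // rcoset_refl.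
Qed.

Let t_inj g i j : (g * (t i)^-1)%g \in H -> (g * (t j)^-1)%g \in H -> i = j.
Proof.
rewrite -!mem_rcoset => /rcoset_eqP gi /rcoset_eqP gj.
by apply: enum_val_inj; rewrite !tE -gi -gj.
Qed.

Fact ind_mx_repr : mx_repr G ind_mx.
Proof.
split=> [|x y Gx Gy].
  rewrite -mxdiagZ; apply: eq_mxblock => i j; rewrite mulg1.
  have [<-|ne_ij] := eqVneq i j; first by rewrite mulgV group1 repr_mx1 conform_mx_id.
  case: ifP => // tij; case/eqP: ne_ij; apply: (t_inj _ tij).
  by rewrite mulgV group1.
rewrite mul_mxblock; apply: eq_mxblock => i k.
have [j Hj] : exists j, (t i * x * (t j)^-1)%g \in H by apply: t_ex; rewrite groupM.
rewrite (bigD1 j) //= Hj big1 ?addr0 => [|l ne_lj]; last first.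
  case: ifP => Hl; last by rewrite mul0mx.
  by case/eqP: ne_lj; apply: t_inj Hl Hj.
have -> : (t i * (x * y) * (t k)^-1)%g
    = ((t i * x * (t j)^-1) * (t j * y * (t k)^-1))%g.
  by rewrite !mulgA mulgKV.
rewrite groupMl //; case: ifP => Hk; last by rewrite mulmx0.
by rewrite repr_mxM.
Qed.

Definition ind_repr : representation F G :=
  Representation (MxRepresentation ind_mx_repr).

End InducedRepresentation.

Lemma cfRepr_ind (gT : finGroupType) (H G : {group gT}) (sHG : H \subset G)
    (d : nat) (W : mx_representation algC H d) :
  cfRepr (ind_repr sHG W) = 'Ind[G] (cfRepr W).
Proof.
apply/cfun_inP=> g Gg; rewrite cfIndE // !cfunE Gg mxtrace_mxblock.
apply: (mulfI (neq0CG H)); rewrite mulVKf ?neq0CG // mulr_sumr.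
rewrite (reindex_inj invg_inj) /=.
rewrite (eq_bigl (fun x => x \in G)); last by move=> x; rewrite groupV.
rewrite (partition_big_imset (fun x => H :* x)%g) /=.
have <- : rcosets H G = [set (H :* x)%g | x in G].
  by apply/setP=> C; apply/rcosetsP/imsetP.
rewrite [RHS]big_enum_val /=.
apply: eq_bigr => i _; set t := ind_transversal i.
have [x Gx eC] := rcosetsP (enum_valP i).
have tE : enum_val i = (H :* t)%g by rewrite /t /ind_transversal eC rcoset_repr.
have Gt : t \in G.
  rewrite /t /ind_transversal eC; have [h Hh] := repr_rcosetP H x.
  by rewrite groupM // (subsetP sHG).
transitivity (\sum_(y in (H :* t)%g) (cfRepr W (g ^ (t^-1)%g)%g)).
  rewrite sumr_const card_rcoset -[RHS]mulr_natl. congr (_ * _).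
  rewrite cfunE conjgE invgK mulgA; case: ifP => //.
  by rewrite mxtrace0.
rewrite tE; apply: eq_big => [y | y /rcosetP[h Hh ->]].
  apply/idP/andP => [Hy | [_ /eqP<-]]; last exact: rcoset_refl.
  split; last by apply/eqP; apply/rcoset_eqP.
  by case/rcosetP: Hy => h Hh ->; rewrite groupM // (subsetP sHG).
by rewrite invMg conjgM [RHS]cfunJ ?groupV.
Qed.

Section OneDimensional.

Variable F : fieldType.

Fact triv_mx_repr (gT : finGroupType) (G : {group gT}) :
  mx_repr G (fun _ : gT => 1%:M : 'M[F]_1).
Proof. by split=> // x y _ _; rewrite mulmx1. Qed.

Definition triv_repr (gT : finGroupType) (G : {group gT}) :
  mx_representation F G 1 := MxRepresentation (triv_mx_repr G).

Fact sgn_mx_repr (n : nat) :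
  mx_repr [set: 'S_n] (fun s : 'S_n => ((-1) ^+ s)%:M : 'M[F]_1).
Proof.
split=> [|s t _ _]; first by rewrite odd_perm1.
by rewrite odd_permM signr_addb scalar_mxM.
Qed.

Definition sgn_repr (n : nat) : mx_representation F [set: 'S_n] 1 :=
  MxRepresentation (sgn_mx_repr n).

End OneDimensional.

(* The multiplicity of the irreducible representation V in rG: [irr_comp] is   *)
(* the isomorphism type of V, and [standard_irr_coef] counts the copies of     *)
(* that type in the decomposition of rG (see [mx_rsim_standard]).              *)
Definition irr_multiplicity (gT : finGroupType) (G : {group gT}) (n d : nat)
    (rG : mx_representation algC G n) (V : mx_representation algC G d) : nat :=
  standard_irr_coef rG (irr_comp (DecSocleType (regular_repr algC G)) V).

(* Main.v *)
Require Import Defs.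
From mathcomp Require Import all_boot all_order all_algebra all_fingroup.
From mathcomp Require Import all_solvable all_field all_character.
From mathcomp Require Import ring.
Set Implicit Arguments.
Unset Strict Implicit.
Unset Printing Implicit Defensive.
Import GroupScope GRing.Theory Num.Theory.
Local Open Scope ring_scope.

(** Both class functions can be written down explicitly, and they agree.

    At X = 1 the necklace polynomial M_b (b > 1) vanishes, because the sum of
    the Moebius function over the divisors of b is 0, and its derivative there
    is phi(b) / b, by Moebius inversion of the identity that sums phi over
    divisors.  As the cycle polynomial of [b^a] is binom(M_b, a), dividing by
    X - 1 and evaluating at 1 is differentiating at 1, which yields
    (-1)^(a-1) phi(b) / (ab).  For b = 1 the recursion defining omega_n
    telescopes to the same formula; so with n = ab
      omega_n(C_[b^a]) = (-1)^(a-1) phi(b) / n                  ([omega_nseq])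
    for all a, b >= 1, while omega_n is 0 on all other classes ([omega_eq0]).

    On the other side, the group H generated by an n-cycle acts freely on the
    n points, so an element of order b has cycle type [b^a] with ab = n; its
    sign is (-1)^a when n is even, and there are phi(b) such elements.  The
    induced character at g is the sum of these signs over the elements of H
    conjugate to g, times |C(g)| / n, and n! = |C(g)| |class of g|; this is
    -n! omega_n(g) ([omega_ind_sgn]).  The mass omega_n(C_lam) is spread over
    all the permutations of cycle type lam, and the argument needs that they
    form one conjugacy class ([cycle_class_classg]).

    The degree is the index (n-1)! of H.  The multiplicities follow from
    Frobenius reciprocity: the sign character restricted to H is linear, hence
    irreducible, and it is nontrivial since an n-cycle is odd for n even.
    If the induced representation were irreducible it would be the sign
    representation, whose degree is 1 < (n-1)! as soon as n > 2. *)

(** * The Moebius function and the totient *)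

Lemma moebiusE d : moebius d =
  if all (fun p => logn p d == 1%N) (primes d) then (-1) ^+ size (primes d)
  else 0.
Proof. by rewrite /moebius prime_decompE all_map. Qed.

Lemma moebius1 : moebius 1 = 1. Proof. by rewrite moebiusE. Qed.

Lemma moebius_primeM p d : prime p -> (0 < d)%N -> ~~ (p %| d)%N ->
  moebius (p * d) = - moebius d.
Proof.
move=> p_pr d_gt0 p_d; have p_gt0 := prime_gt0 p_pr.
have p'd : p \notin primes d by rewrite mem_primes p_pr d_gt0.
have perm_pd : perm_eq (primes (p * d)) (p :: primes d).
  apply: uniq_perm; rewrite /= ?primes_uniq ?p'd // => q.
  by rewrite primesM // primes_prime // !inE.
rewrite !moebiusE (perm_size perm_pd) (perm_all _ perm_pd) /= lognM //.
rewrite logn_prime // eqxx [logn p d]lognE (negPf p_d) !andbF /= exprS mulN1r.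
have -> : all (fun q => logn q (p * d) == 1%N) (primes d)
          = all (fun q => logn q d == 1%N) (primes d).
  apply: eq_in_all => q q_d; rewrite lognM // logn_prime //.
  by have [eq_qp|//] := eqVneq q p; rewrite -eq_qp q_d in p'd.
by case: ifP; rewrite ?oppr0.
Qed.

Lemma moebius_sqr_dvd p d : prime p -> (0 < d)%N -> (p %| d)%N ->
  moebius (p * d) = 0.
Proof.
move=> p_pr d_gt0 p_d; have p_gt0 := prime_gt0 p_pr.
rewrite moebiusE; case: allP => // /(_ p); rewrite primesM // primes_prime //.
rewrite inE eqxx => /(_ isT); rewrite lognM // logn_prime // eqxx add1n eqSS.
by rewrite -leqn0 leqNgt logn_gt0 mem_primes p_pr d_gt0 p_d.
Qed.

(** Let p be a prime factor of n.  A divisor d = p e with p | e contributes 0, and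
    the remaining divisors pair off as e, p e with opposite contributions. *)
Lemma sum_moebius n : (1 < n)%N -> \sum_(d <- divisors n) moebius d = 0.
Proof.
move=> n_gt1; have n_gt0 := ltnW n_gt1.
have [p p_pr p_n] : exists2 p, prime p & (p %| n)%N.
  by exists (pdiv n); rewrite ?pdiv_prime ?pdiv_dvd.
have p_gt0 := prime_gt0 p_pr.
rewrite (bigID (fun d => p %| d)%N) /=; apply/eqP; rewrite addr_eq0 -sumrN.
have -> : \sum_(d <- divisors n | (p %| d)%N) moebius d
    = \sum_(d <- divisors n | (p %| d)%N && ~~ (p %| d %/ p)%N) moebius d.
  rewrite big_mkcondr /=; rewrite big_seq_cond [RHS]big_seq_cond.
  apply: eq_bigr => d; rewrite -dvdn_divisors // => /andP[d_n p_d].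
  have d_gt0 := dvdn_gt0 n_gt0 d_n.
  case: ifPn => //; rewrite negbK => pp_d.
  by rewrite -(divnK p_d) mulnC moebius_sqr_dvd // divn_gt0 // dvdn_leq.
have -> : \sum_(d <- divisors n | ~~ (p %| d)%N) - moebius d
    = \sum_(d <- divisors n | ~~ (p %| d)%N) moebius (p * d).
  rewrite big_seq_cond [RHS]big_seq_cond.
  apply: eq_bigr => d; rewrite -dvdn_divisors // => /andP[d_n p_d].
  by rewrite moebius_primeM // (dvdn_gt0 n_gt0).
rewrite -big_filter -[X in _ == X]big_filter.
rewrite -[X in _ == X](big_map (muln p) xpredT).
apply/eqP/perm_big/uniq_perm.
- by rewrite filter_uniq ?divisors_uniq.
- rewrite map_inj_uniq ?filter_uniq ?divisors_uniq // => i j /eqP.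
  by rewrite eqn_pmul2l // => /eqP.
move=> d; rewrite mem_filter -dvdn_divisors //; apply/idP/mapP.
  case/andP=> /andP[p_d pp_d] d_n; exists (d %/ p)%N; last by rewrite mulnC divnK.
  by rewrite mem_filter pp_d -dvdn_divisors // (dvdn_trans _ d_n) ?dvdn_div.
case=> e; rewrite mem_filter -dvdn_divisors // => /andP[p_e e_n] ->.
rewrite dvdn_mulr // mulKn // p_e Gauss_dvd ?p_n ?e_n //.
by rewrite prime_coprime.
Qed.

(** This is what lets the two sums over d | n and e | n/d be exchanged. *)
Lemma sum_divisors_quo (V : nmodType) n d (F : nat -> V) :
  (0 < n)%N -> (d %| n)%N ->
  \sum_(e <- divisors (n %/ d)) F e = \sum_(e <- divisors n | (d * e %| n)%N) F e.
Proof.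
move=> n_gt0 d_n; have d_gt0 := dvdn_gt0 n_gt0 d_n.
have nd_gt0 : (0 < n %/ d)%N by rewrite divn_gt0 // dvdn_leq.
rewrite -[RHS]big_filter; apply/perm_big/uniq_perm.
- exact: divisors_uniq.
- by rewrite filter_uniq ?divisors_uniq.
move=> e; rewrite mem_filter -!dvdn_divisors // mulnC -dvdn_divRL //.
by case: (boolP (e %| n %/ d)%N) => // e_nd; rewrite (dvdn_trans e_nd) ?dvdn_div.
Qed.

Lemma sum_totient_divisors n : (0 < n)%N -> (\sum_(d <- divisors n) totient d)%N = n.
Proof.
move=> n_gt0; rewrite -{2}(sum_totient_dvd n).
rewrite -(big_mkord (fun d => d %| n)%N) -[in RHS]big_filter.
apply/perm_big/uniq_perm.
- exact: divisors_uniq.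
- by rewrite filter_uniq ?iota_uniq.
move=> d; rewrite mem_filter -dvdn_divisors // mem_index_iota ltnS /=.
by case: (boolP (d %| n)%N) => // /(dvdn_leq n_gt0) ->.
Qed.

(** Moebius inversion: expand n/d as the sum of phi(e) over e | n/d and sum over
    d first; by [sum_moebius] only e = n survives. *)
Lemma sum_moebius_totient n : (0 < n)%N ->
  \sum_(d <- divisors n) moebius d * (n %/ d)%:R = (totient n)%:R.
Proof.
move=> n_gt0.
transitivity (\sum_(d <- divisors n) \sum_(e <- divisors n | (d * e %| n)%N)
                moebius d * (totient e)%:R).
  apply: eq_big_seq => d; rewrite -dvdn_divisors // => d_n.
  rewrite -sum_divisors_quo // -mulr_sumr -natr_sum sum_totient_divisors //.
  by rewrite divn_gt0 // dvdn_leq // (dvdn_gt0 n_gt0).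
rewrite (exchange_big_dep xpredT) //=.
rewrite (eq_big_seq (fun e => if e == n then (totient n)%:R else 0)); last first.
  move=> e; rewrite -dvdn_divisors // => e_n.
  under eq_bigl do rewrite mulnC.
  rewrite -mulr_suml -sum_divisors_quo //; have [->|e_neq] := eqVneq.
    by rewrite divnn n_gt0 /= big_seq1 moebius1 mul1r.
  rewrite sum_moebius ?mul0r //.
  by rewrite ltn_divRL // mul1n ltn_neqAle e_neq dvdn_leq.
rewrite -big_mkcond /= -big_filter (perm_big [:: n]) ?big_seq1 //.
apply: uniq_perm; rewrite ?filter_uniq ?divisors_uniq // => e.
by rewrite mem_filter inE -dvdn_divisors //; case: eqP => // ->; rewrite dvdnn.
Qed.

(** * Values of the splitting measure and of omega *)

(** The quotient of a polynomial by X - 1, at its root 1, is the derivative. *)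
Lemma splitting_measure1E n lam : root (cycle_poly n lam) 1 ->
  splitting_measure1 n lam = (cycle_poly n lam)^`().[1].
Proof.
rewrite /splitting_measure1 => /factor_theorem[q ->].
rewrite hornerXn expr1n divr1 mulpK ?polyXsubC_eq0 //.
by rewrite derivM derivXsubC mulr1 hornerD hornerM hornerXsubC subrr mulr0 add0r.
Qed.

Lemma binomial_poly0 p : binomial_poly p 0 = 1.
Proof. by rewrite /binomial_poly big_ord0 fact0 invr1 scale1r. Qed.

Lemma cycle_poly_nseq n a b : (0 < b <= n)%N ->
  cycle_poly n (nseq a b) = binomial_poly (necklace_poly b) a.
Proof.
move=> b_n; rewrite /cycle_poly (bigD1_seq b) ?mem_index_iota ?iota_uniq //=.
rewrite count_nseq /= eqxx mul1n big1 ?mulr1 // => j j_b.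
by rewrite count_nseq /= eq_sym (negPf j_b) binomial_poly0.
Qed.

Lemma prod_oppr_succ (R : comPzRingType) k :
  \prod_(i < k) - (i.+1%:R : R) = (-1) ^+ k * k`!%:R.
Proof.
elim: k => [|k IHk]; first by rewrite big_ord0 mul1r.
by rewrite big_ord_recr IHk /= exprS factS natrM; ring.
Qed.

Lemma hornerB_natr (R : nzRingType) (p : {poly R}) i x :
  (p - i%:R).[x] = p.[x] - i%:R.
Proof. by rewrite hornerD hornerN -polyC_natr hornerC. Qed.

Lemma root_binomial_poly q k : q.[1] = 0 -> root (binomial_poly q k.+1) 1.
Proof.
move=> q1; rewrite rootE /binomial_poly hornerZ big_ord_recl hornerM.
by rewrite hornerB_natr q1 subrr mul0r mulr0.
Qed.

(** Only the factor q of q (q - 1) ... (q - k) vanishes at 1, so only its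
    derivative contributes, multiplied by (-1)(-2)...(-k). *)
Lemma deriv_binomial_poly_root q k : q.[1] = 0 ->
  (binomial_poly q k.+1)^`().[1] = (-1) ^+ k * q^`().[1] / k.+1%:R.
Proof.
move=> q1; rewrite /binomial_poly derivZ hornerZ big_ord_recl derivM /=.
rewrite subr0 hornerD !hornerM q1 mul0r addr0 horner_prod.
under eq_bigr do rewrite hornerB_natr q1 add0r.
rewrite prod_oppr_succ factS natrM.
have k_neq0 : k.+1%:R != 0 :> rat by rewrite pnatr_eq0.
have f_neq0 : k`!%:R != 0 :> rat by rewrite pnatr_eq0 -lt0n fact_gt0.
by field; rewrite f_neq0 nat1r k_neq0.
Qed.

(** Here the factor that vanishes at 1 is X - 1, which is pulled to the front. *)
Lemma binomial_polyXE k : binomial_poly 'X k.+2 =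
  (k.+2)`!%:R^-1 *: (('X - 1%:P) * ('X * \prod_(i < k) ('X - i.+2%:R))).
Proof. by rewrite /binomial_poly !big_ord_recl mulrCA subr0. Qed.

Lemma root_binomial_polyX k : root (binomial_poly 'X k.+2) 1.
Proof.
by rewrite binomial_polyXE rootE hornerZ hornerM hornerXsubC subrr mul0r mulr0.
Qed.

Lemma deriv_binomial_polyX k :
  (binomial_poly 'X k.+2)^`().[1] = (-1) ^+ k / (k.+1%:R * k.+2%:R).
Proof.
rewrite binomial_polyXE derivZ hornerZ derivM derivXsubC mul1r hornerD.
rewrite !hornerM hornerXsubC subrr mul0r addr0 hornerX mul1r horner_prod.
under eq_bigr => i _.
  rewrite hornerB_natr hornerX -[i.+2]addn1 natrD opprD addrCA subrr addr0.
  over.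
rewrite prod_oppr_succ !factS !natrM.
have k_neq0 : k.+1%:R != 0 :> rat by rewrite pnatr_eq0.
have k2_neq0 : k.+2%:R != 0 :> rat by rewrite pnatr_eq0.
have f_neq0 : k`!%:R != 0 :> rat by rewrite pnatr_eq0 -lt0n fact_gt0.
by field; rewrite f_neq0 -(natrD _ 2) add2n nat1r k2_neq0 k_neq0.
Qed.

Lemma necklace_poly1 : necklace_poly 1 = 'X.
Proof.
by rewrite /necklace_poly invr1 scale1r big_seq1 moebius1 scale1r divn1 expr1.
Qed.

Lemma necklace_poly_horner1 b : (1 < b)%N -> (necklace_poly b).[1] = 0.
Proof.
move=> b_gt1; rewrite /necklace_poly hornerZ horner_sum.
under eq_bigr do rewrite hornerZ hornerXn expr1n mulr1.
by rewrite -(rmorph_sum intr) /= sum_moebius // mulr0.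
Qed.

Lemma deriv_necklace_poly_horner1 b : (0 < b)%N ->
  (necklace_poly b)^`().[1] = (totient b)%:R / b%:R.
Proof.
move=> b_gt0; rewrite /necklace_poly derivZ hornerZ raddf_sum horner_sum /=.
under eq_bigr do rewrite derivZ hornerZ derivXn hornerMn hornerXn expr1n
  -[_%:R]mulrz_nat -intrM.
rewrite -(rmorph_sum intr) /= mulrC; congr (_ / _).
by rewrite -[RHS]mulrz_nat; congr intr; rewrite -sum_moebius_totient.
Qed.

Lemma splitting_measure1_nseq a b : (0 < a)%N -> (1 < b)%N ->
  splitting_measure1 (a * b) (nseq a b)
    = (-1) ^+ a.-1 * (totient b)%:R / (a * b)%:R.
Proof.
case: a => // a _ b_gt1; have b_gt0 := ltnW b_gt1.
have b_n : (0 < b <= a.+1 * b)%N by rewrite b_gt0 leq_pmull.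
have M1 := necklace_poly_horner1 b_gt1.
rewrite splitting_measure1E !cycle_poly_nseq ?root_binomial_poly //.
rewrite deriv_binomial_poly_root // deriv_necklace_poly_horner1 // natrM.
have a_neq0 : a.+1%:R != 0 :> rat by rewrite pnatr_eq0.
have b_neq0 : b%:R != 0 :> rat by rewrite pnatr_eq0 -lt0n.
by field; rewrite b_neq0 nat1r a_neq0.
Qed.

Lemma splitting_measure1_ones k :
  splitting_measure1 k.+2 (nseq k.+2 1%N) = (-1) ^+ k / (k.+1%:R * k.+2%:R).
Proof.
rewrite splitting_measure1E !cycle_poly_nseq // necklace_poly1.
  exact: deriv_binomial_polyX.
exact: root_binomial_polyX.
Qed.

(** The recursion solves to (-1)^(n-1) / n, because
    (-1)^n / (n (n-1)) - (-1)^(n-2) / (n-1) = (-1)^(n-1) / n. *)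
Lemma omega_ones k : omega k.+1 (nseq k.+1 1%N) = (-1) ^+ k / k.+1%:R.
Proof.
elim: k => [|k IHk]; first by rewrite divr1.
have -> : omega k.+2 (nseq k.+2 1%N) = splitting_measure1 k.+2 (nseq k.+2 1%N)
    - omega k.+1 (nseq k.+1 1%N) by rewrite /= eqxx.
rewrite splitting_measure1_ones IHk exprS.
have k_neq0 : k.+1%:R != 0 :> rat by rewrite pnatr_eq0.
have k2_neq0 : k.+2%:R != 0 :> rat by rewrite pnatr_eq0.
by field; rewrite -(natrD _ 2) add2n nat1r k2_neq0 k_neq0.
Qed.

Lemma omega_nseq a b : (0 < a)%N -> (0 < b)%N ->
  omega (a * b) (nseq a b) = (-1) ^+ a.-1 * (totient b)%:R / (a * b)%:R.
Proof.
move=> a_gt0 b_gt0; have [b_gt1|] := ltnP 1 b; last first.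
  rewrite leq_eqVlt ltnS leqNgt b_gt0 orbF => /eqP->.
  by rewrite muln1 -[totient 1]/1%N mulr1; case: a a_gt0 => // k _; exact: omega_ones.
rewrite -splitting_measure1_nseq //.
have n_gt1 : (1 < a * b)%N by rewrite (leq_trans b_gt1) ?leq_pmull.
have rect : is_rectangular (a * b) (nseq a b).
  have a_lt : (a < (a * b).+1)%N by rewrite ltnS leq_pmulr.
  have b_lt : (b < (a * b).+1)%N by rewrite ltnS leq_pmull.
  apply/existsP; exists (Ordinal a_lt); apply/existsP; exists (Ordinal b_lt).
  by rewrite /= !eqxx b_gt1.
case: (a * b)%N n_gt1 rect => [|[|n]] // _ rect; rewrite /omega rect.
case: eqP => //; case: a a_gt0 {rect} => // a _ [b1 _].
by rewrite b1 in b_gt1.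
Qed.

Lemma omega_eq0 n lam : (forall a b, (a * b)%N = n -> lam != nseq a b) ->
  omega n lam = 0.
Proof.
case: n => [|[|n]] // lam_n; first by rewrite /= (negPf (lam_n 1%N 1%N _)).
rewrite /omega (negPf (lam_n n.+2 1%N _)) ?muln1 //.
case: ifP => // /existsP[a /existsP[b /and3P[/eqP ab _ lamE]]].
by case/negP: (lam_n _ _ ab).
Qed.

(** * Permutations of equal cycle type are conjugate *)

(** The powers of u send x around a cycle of length exactly [#|porbit u x|]. *)
Lemma permX_eq_mod (T : finType) (u : {perm T}) x i j :
  ((u ^+ i)%g x == (u ^+ j)%g x) = (i == j %[mod #|porbit u x|]).
Proof.
set n := #|porbit u x|; have n_gt0 : (0 < n)%N by rewrite lt0n card_porbit_neq0.
have red k : (u ^+ k)%g x = nth x (traject u x n) (k %% n).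
  rewrite nth_traject ?ltn_mod // {1}(divn_eq k n) addnC expgD permM !permX.
  rewrite -!permX.
  suff -> : forall q, (u ^+ (q * n))%g ((u ^+ (k %% n))%g x) = (u ^+ (k %% n))%g x by [].
  elim=> [|q IHq]; first by rewrite mul0n expg0 perm1.
  rewrite mulSn expgD permM -[X in _ = X]IHq; congr ((u ^+ _)%g _).
  by rewrite -permM -expgD addnC expgD permM !permX iter_porbit.
by rewrite !red nth_uniq ?size_traject ?ltn_mod ?uniq_traject_porbit.
Qed.

(** Sorting the orbits of s and of t by size gives two lists with the same
    sizes; f matches the orbits in the same position.  Choosing a base point in
    every orbit and sending s^k (base point of X) to t^k (base point of f X) is
    a well-defined bijection, since X and f X have the same size, and it
    conjugates s to t. *)
Section Conjugacy.

Variables (T : finType) (s t : {perm T}) (x0 : T).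
Hypothesis eq_st : cycle_type s = cycle_type t.

Local Notation by_size := (relpre (fun X : {set T} => #|X|) geq).
Let ps := sort by_size (enum (porbits s)).
Let pt := sort by_size (enum (porbits t)).
Let f (X : {set T}) : {set T} := nth set0 pt (index X ps).
(* The default x0 is never reached: rep is only applied to orbits. *)
Let rep (X : {set T}) : T := odflt x0 [pick x in X].

Let card_eq : [seq #|pred_of_set X| | X <- ps] = [seq #|pred_of_set X| | X <- pt].
Proof. by move: eq_st; rewrite /cycle_type !sort_map. Qed.

Let mem_ps X : (X \in ps) = (X \in porbits s).
Proof. by rewrite mem_sort mem_enum. Qed.

Let mem_pt X : (X \in pt) = (X \in porbits t).
Proof. by rewrite mem_sort mem_enum. Qed.

Let size_eq : size ps = size pt.
Proof. by rewrite -(size_map (fun X : {set T} => #|X|)) card_eq size_map. Qed.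

Let f_porbits X : X \in porbits s -> f X \in porbits t.
Proof. by rewrite -mem_ps -mem_pt => Xs; rewrite mem_nth // -size_eq index_mem. Qed.

Let f_inj : {in porbits s &, injective f}.
Proof.
move=> X Y; rewrite -!mem_ps => Xs Ys /eqP.
rewrite nth_uniq -?size_eq ?index_mem ?sort_uniq ?enum_uniq // => /eqP eqXY.
by rewrite -(nth_index set0 Xs) eqXY nth_index.
Qed.

Let card_f X : X \in porbits s -> #|f X| = #|X|.
Proof.
rewrite -mem_ps => Xs; have i_lt : (index X ps < size ps)%N by rewrite index_mem.
rewrite -[in RHS](nth_index set0 Xs) /f.
have := congr1 (nth 0 ^~ (index X ps)) card_eq.
by rewrite (nth_map set0) // (nth_map set0) -?size_eq.
Qed.

Let rep_in (u : {perm T}) X : X \in porbits u -> rep X \in X.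
Proof.
case/imsetP=> x _ ->; rewrite /rep; case: pickP => //= /(_ x).
by rewrite porbit_id.
Qed.

Let porbit_rep (u : {perm T}) X : X \in porbits u -> porbit u (rep X) = X.
Proof.
move=> Xu; have := rep_in Xu; case/imsetP: Xu => x _ ->.
by rewrite -eq_porbit_mem => /eqP.
Qed.

Let idx x := index x (traject s (rep (porbit s x)) #|porbit s x|).
Let phi x := (t ^+ idx x)%g (rep (f (porbit s x))).

Let idxP x : (s ^+ idx x)%g (rep (porbit s x)) = x.
Proof.
have Xs : porbit s x \in porbits s by apply: imset_f.
have x_in : x \in traject s (rep (porbit s x)) #|porbit s x|.
  by rewrite -{2}(porbit_rep Xs) -porbit_traject porbit_rep ?porbit_id.
have i_lt : (idx x < #|porbit s x|)%N.
  by rewrite -[X in (_ < X)%N](size_traject s (rep (porbit s x))) index_mem.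
by rewrite permX -(nth_traject _ i_lt) nth_index.
Qed.

Let phiE X k : X \in porbits s -> phi ((s ^+ k)%g (rep X)) = (t ^+ k)%g (rep (f X)).
Proof.
move=> Xs; set x := (s ^+ k)%g (rep X).
have eX : porbit s x = X by rewrite porbit_perm porbit_rep.
have := idxP x; rewrite /phi eX => /eqP.
rewrite permX_eq_mod porbit_rep // -(card_f Xs) => eq_mod; apply/eqP.
by rewrite permX_eq_mod porbit_rep ?f_porbits.
Qed.

Let phi_inj : injective phi.
Proof.
move=> x y eq_xy; have Xs : porbit s x \in porbits s by apply: imset_f.
have Ys : porbit s y \in porbits s by apply: imset_f.
have eqX : porbit s x = porbit s y.
  apply: f_inj => //; rewrite -(porbit_rep (f_porbits Xs)).
  rewrite -(porbit_rep (f_porbits Ys)) -(porbit_perm t (idx x)).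
  by rewrite -[in RHS](porbit_perm t (idx y)) -/(phi x) eq_xy.
have /eqP := eq_xy; rewrite /phi -eqX permX_eq_mod porbit_rep ?f_porbits //.
have := permX_eq_mod s (rep (porbit s x)) (idx x) (idx y).
by rewrite card_f // porbit_rep // => <- /eqP; rewrite idxP eqX idxP.
Qed.

Let conj_phi : t = (s ^ perm phi_inj)%g.
Proof.
apply/permP=> z; pose y := ((perm phi_inj)^-1)%g z.
have -> : z = perm phi_inj y by rewrite permKV.
rewrite permJ !permE -{2}(idxP y).
have Xs : porbit s y \in porbits s by apply: imset_f.
by rewrite -permM -expgSr phiE // expgSr permM.
Qed.

Lemma cycle_type_conj_nonempty : exists x, t = (s ^ x)%g.
Proof. by exists (perm phi_inj). Qed.

End Conjugacy.

Lemma cycle_type_conj (T : finType) (s t : {perm T}) :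
  cycle_type s = cycle_type t -> exists x, t = (s ^ x)%g.
Proof.
have [x0 _ eq_st|no_x _] := pickP (fun _ : T => true).
  exact: cycle_type_conj_nonempty x0 eq_st.
by exists 1%g; apply/permP=> x; have := no_x x.
Qed.

Lemma cycle_class_classg n (s : 'S_n) :
  cycle_class n (cycle_type s) = (s ^: [set: 'S_n])%g.
Proof.
apply/setP=> t; rewrite inE; apply/eqP/imsetP => [eq_ts | [x _ ->]].
  by have [x ->] := cycle_type_conj (esym eq_ts); exists x.
exact: cycle_typeJ.
Qed.

(** * Cyclic groups generated by a full cycle *)

Lemma porbits_partition (T : finType) (s : {perm T}) :
  partition (porbits s) [set: T].
Proof.
have -> : porbits s = [set orbit 'P <[s]> x | x in [set: T]].
  by apply/setP=> X; apply/imsetP/imsetP=> -[x _ ->]; exists x; rewrite ?porbitE ?inE.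
by apply: orbit_partition; apply/actsP=> a _ x; rewrite !inE.
Qed.

Lemma cycle_type_uniform (T : finType) (s : {perm T}) b :
  (forall x, #|porbit s x| = b) -> cycle_type s = nseq #|porbits s| b.
Proof.
move=> card_b; have -> : cycle_type s = sort geq (nseq #|porbits s| b).
  congr (sort _ _); rewrite cardE -(size_map (fun X : {set T} => #|X|)).
  apply/all_pred1P/allP=> _ /mapP[X + ->].
  by rewrite mem_enum => /imsetP[x _ ->]; rewrite /= card_b.
rewrite sorted_sort //; first by move=> x y z /= yx zy; apply: leq_trans zy yx.
by elim: #|_| => //= -[|k] //= ->; rewrite leqnn.
Qed.

Section FullCycle.

Variables (T : finType) (c : {perm T}).
Hypothesis cyc_c : cycle_type c = [:: #|T|].

Lemma card_porbits_full_cycle : #|porbits c| = 1%N.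
Proof.
by have := congr1 size cyc_c; rewrite size_sort size_map -cardE.
Qed.

Lemma porbit_full_cycle x : porbit c x = [set: T].
Proof.
have /eqP/cards1P[X porbE] := card_porbits_full_cycle.
apply/setP=> y; rewrite inE -eq_porbit_mem.
have inX z : porbit c z \in [set X] by rewrite -porbE imset_f.
by rewrite (set1P (inX x)) (set1P (inX y)) eqxx.
Qed.

(** The group generated by c is abelian and transitive, so a fixed point of h is
    carried to every other point. *)
Lemma full_cycle_semiregular h x : h \in <[c]>%g -> h x = x -> h = 1%g.
Proof.
case/cycleP=> i -> fix_x; apply/permP=> y; rewrite perm1.
have /porbitP[j ->] : y \in porbit c x by rewrite porbit_full_cycle inE.
by rewrite -permM -expgD addnC expgD permM fix_x.
Qed.

Lemma card_porbit_full_cycle h x : h \in <[c]>%g -> #|porbit h x| = #[h]%g.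
Proof.
move=> c_h; apply/eqP; rewrite eqn_dvd {1}porbitE dvdn_orbit order_dvdn /=.
apply/eqP/(full_cycle_semiregular (x := x)); first exact: groupX.
by rewrite permX iter_porbit.
Qed.

Lemma card_full_cycle_order h : h \in <[c]>%g -> #|T| = (#|porbits h| * #[h]%g)%N.
Proof.
move=> c_h; rewrite -cardsT.
apply: card_uniform_partition (porbits_partition h) => _ /imsetP[x _ ->].
exact: card_porbit_full_cycle.
Qed.

Lemma order_full_cycle : #[c]%g = #|T|.
Proof.
by rewrite (card_full_cycle_order (cycle_id c)) card_porbits_full_cycle mul1n.
Qed.

Lemma cycle_type_full_cycle h :
  h \in <[c]>%g -> cycle_type h = nseq #|porbits h| #[h]%g.
Proof.
by move=> c_h; apply: cycle_type_uniform => x; apply: card_porbit_full_cycle.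
Qed.

(** Since ab is the number of points, either of a and b determines the other, so
    the order of h determines its cycle type. *)
Lemma full_cycle_type_nseq a b h : (0 < a)%N -> (0 < b)%N -> (a * b)%N = #|T| ->
  h \in <[c]>%g -> (cycle_type h == nseq a b) = (#[h]%g == b).
Proof.
move=> a_gt0 b_gt0 ab c_h; rewrite cycle_type_full_cycle //.
have := card_full_cycle_order c_h; rewrite -ab => eq_ab.
apply/eqP/eqP => [eq_nseq | h_b]; last first.
  by move/eqP: eq_ab; rewrite h_b eqn_pmul2r // => /eqP->.
have /(congr1 size) := eq_nseq; rewrite !size_nseq => eq_a.
by move/eqP: eq_ab; rewrite eq_a eqn_pmul2l // => /eqP.
Qed.

End FullCycle.

(** The elements of order d are the generators of the only subgroup of order d
    of the cyclic group. *)
Lemma card_order_cycle (gT : finGroupType) (x : gT) d : (d %| #[x])%g%N ->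
  #|[set y in <[x]>%g | #[y]%g == d]| = totient d.
Proof.
move=> d_x; have x_gt0 := order_gt0 x; have d_gt0 := dvdn_gt0 x_gt0 d_x.
set z := (x ^+ (#[x] %/ d))%g.
have oz : #[z]%g = d by rewrite orderXdiv ?dvdn_div // divnA // mulKn.
rewrite -{2}oz totient_gen; apply: eq_card => y; rewrite !inE.
apply/andP/idP=> [[x_y /eqP oy]|gen_y].
  rewrite /generator (eq_subG_cyclic (cycle_cyclic x)) ?cycle_subG ?mem_cycle //.
  by rewrite -!orderE oz oy.
split; last by rewrite -(generator_order gen_y) oz.
by rewrite -cycle_subG -(eqP gen_y) cycle_subG mem_cycle.
Qed.

(** The y conjugating x to a given z form a coset of the centraliser of x. *)
Lemma sum_conjg (V : nmodType) (gT : finGroupType) (G : {group gT}) x (F : gT -> V) :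
  x \in G ->
  \sum_(y in G) F (x ^ y)%g = \sum_(z in (x ^: G)%g) F z *+ #|'C_G[x]%g|.
Proof.
move=> Gx; rewrite (partition_big_imset (fun y => (x ^ y)%g)) /=.
apply: eq_bigr => _ /imsetP[y Gy ->].
rewrite (eq_bigr (fun _ => F (x ^ y)%g)) => [|z /andP[_ /eqP->] //].
rewrite sumr_const -astab1J -(card_rcoset _ y) -amove_act ?subsetT //.
by congr (_ *+ _); apply: eq_card => z; rewrite [RHS]inE.
Qed.

(** * Multiplicities and the induced sign character *)

(** Orthonormality of the irreducible characters, applied to the decomposition of
    [rG] into its standard components. *)
Lemma irr_multiplicityE (gT : finGroupType) (G : {group gT}) (n d : nat)
    (rG : mx_representation algC G n) (V : mx_representation algC G d) :
  mx_irreducible V -> (irr_multiplicity rG V)%:R = '[cfRepr rG, cfRepr V].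
Proof.
move=> irrV; rewrite /irr_multiplicity; set sG := DecSocleType _.
pose i := irr_of_socle (irr_comp sG V).
have Wi : socle_of_Iirr i = irr_comp sG V by rewrite irr_of_socleK.
have -> : cfRepr V = 'chi_i.
  rewrite -irrRepr; apply: cfRepr_sim; rewrite Wi.
  by apply: rsim_irr_comp_pchar irrV; apply: algC'G_pchar.
rewrite -Wi (cfRepr_sim (mx_rsim_standard rG)) cfRepr_standard cfdot_suml.
rewrite (bigD1 i) //= cfdotZl cfdot_irr eqxx mulr1 big1 ?addr0 // => j j_i.
by rewrite cfdotZl cfdot_irr (negPf j_i) mulr0.
Qed.

Lemma cfRepr_triv (gT : finGroupType) (G : {group gT}) :
  cfRepr (triv_repr algC G) = 1.
Proof.
apply/cfun_inP=> x Gx; rewrite cfunE Gx mxtrace_scalar cfun1E Gx.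
by rewrite mulr1n.
Qed.

Lemma cfRepr_sgn n (s : 'S_n) : cfRepr (sgn_repr algC n) s = (-1) ^+ s.
Proof. by rewrite cfunE inE mxtrace_scalar. Qed.

Lemma cfRepr_sgn_lin n : cfRepr (sgn_repr algC n) \is a linear_char.
Proof. by rewrite qualifE /= /linear_char_pred cfRepr_char cfRepr1 eqxx. Qed.

Lemma odd_perm_even_degree n (s : 'S_n) :
  ~~ odd n -> odd_perm s = odd #|porbits s|.
Proof. by move=> n_even; rewrite /odd_perm card_ord (negPf n_even). Qed.

Section SignInduced.

Variables (n : nat) (c : 'S_n).
Hypotheses (n_gt0 : (0 < n)%N) (n_even : ~~ odd n).
Hypothesis cyc_c : cycle_type c = [:: n].

Local Notation sgn := (cfRepr (sgn_repr algC n)).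
Local Notation H := <[c]>%G.

Let cyc_cT : cycle_type c = [:: #|'I_n|]. Proof. by rewrite card_ord. Qed.

(** The sum over the conjugates of g in H becomes a sum over the elements of H
    with the cycle type of g, each of sign (-1)^(number of its cycles). *)
Lemma sgn_ind_classE g :
  'Ind[[set: 'S_n]] ('Res[H] sgn) g =
  n%:R^-1 * (#|'C[g]%g|%:R *
    \sum_(h in H | cycle_type h == cycle_type g) (-1) ^+ #|porbits h|).
Proof.
rewrite cfIndE ?subsetT // -orderE (order_full_cycle cyc_cT) card_ord.
congr (_ * _); rewrite (sum_conjg _ (in_setT g)) -cycle_class_classg.
rewrite setTI sumrMnl mulr_natl; congr (_ *+ _).
rewrite [LHS]big_mkcond [RHS]big_mkcond /=; apply: eq_bigr => h _.
rewrite inE; case: ifP => _; last by rewrite andbF.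
rewrite andbT; case: ifPn => Hh; last exact: cfun0.
by rewrite cfResE ?subsetT // cfRepr_sgn odd_perm_even_degree // signr_odd.
Qed.

(** If g has type [b^a] with ab = n, the sum in [sgn_ind_classE] has phi(b) terms,
    all equal to (-1)^a; otherwise the sum is empty and omega_n vanishes. *)
Lemma omega_ind_sgn :
  - (n`!)%:R *: omega_cfun n = 'Ind[[set: 'S_n]] ('Res[H] sgn).
Proof.
apply/cfun_inP=> g _; rewrite sgn_ind_classE !cfunE cycle_class_classg.
have card_n : n`! = (#|(g ^: [set: 'S_n])%g| * #|'C[g]%g|)%N.
  by rewrite -index_cent1 setTI mulnC Lagrange ?subsetT // cardsT card_Sn.
have class_neq0 : #|(g ^: [set: 'S_n])%g|%:R != 0 :> algC.
  by rewrite pnatr_eq0 -lt0n; apply/card_gt0P; exists g; apply: class_refl.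
have n_neq0 : n%:R != 0 :> algC by rewrite pnatr_eq0 -lt0n.
have [[a [b [ab gE]]] | no_ab] :
    (exists a b, (a * b)%N = n /\ cycle_type g = nseq a b)
    \/ (forall a b, (a * b)%N = n -> cycle_type g != nseq a b).
  (* If lam = [b^a] with a > 0, then a and b are its length and its head. *)
  set lam := cycle_type g; set a := size lam; set b := head 0%N lam.
  have [/andP[/eqP ab /eqP lamE] | not_ab] :=
    boolP ((a * b == n)%N && (lam == nseq a b)); first by left; exists a, b.
  right=> k l kl; apply: contra not_ab => /eqP lamE; rewrite /a /b lamE.
  case: k kl {lamE} => [|k] /= kl; first by move: n_gt0; rewrite -kl.
  by rewrite size_nseq kl !eqxx.
  have /andP[a_gt0 b_gt0] : (0 < a)%N && (0 < b)%N by rewrite -muln_gt0 ab.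
  have orders h : h \in H -> (cycle_type h == nseq a b) = (#[h]%g == b).
    by apply: full_cycle_type_nseq; rewrite ?card_ord.
  rewrite gE -{2}ab omega_nseq // ab.
  rewrite (eq_bigr (fun _ => (-1) ^+ a)) => [|h /andP[Hh]]; last first.
    rewrite (cycle_type_full_cycle cyc_cT Hh) => /eqP/(congr1 size).
    by rewrite !size_nseq => ->.
  rewrite (eq_bigl (mem [set h in H | #[h]%g == b])) => [|h]; last first.
    by rewrite /= inE; case Hh: (h \in H) => //=; rewrite orders.
  rewrite sumr_const card_order_cycle; last first.
    by rewrite (order_full_cycle cyc_cT) card_ord -ab dvdn_mull.
  rewrite fmorph_div /= rmorphM rmorphXn /= rmorphN1 !ratr_nat card_n natrM.
  rewrite -[in RHS](prednK a_gt0) exprS -mulr_natr.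
  by field; rewrite class_neq0 n_neq0.
rewrite omega_eq0 // big1 => [|h /andP[Hh /eqP eq_hg]].
  by rewrite rmorph0 mul0r !mulr0.
have := card_full_cycle_order cyc_cT Hh; rewrite card_ord => /esym/no_ab.
by rewrite -eq_hg (cycle_type_full_cycle cyc_cT Hh) eqxx.
Qed.

(** The restriction of the sign to H is a linear character taking the value -1 at
    c, hence it is irreducible and differs from the trivial one. *)
Lemma cfdot_ind_sgn_triv : '['Ind[[set: 'S_n]] ('Res[H] sgn), 1] = 0.
Proof.
rewrite -cfdot_Res_r rmorph1.
have /irrP[i Ei] := lin_char_irr (cfRes_lin_char H (cfRepr_sgn_lin n)).
rewrite Ei -irr0 cfdot_irr; case: eqP => // i0; move: Ei; rewrite i0 irr0.
move/cfunP/(_ c); rewrite cfResE ?subsetT ?cycle_id // cfRepr_sgn.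
rewrite odd_perm_even_degree // (card_porbits_full_cycle cyc_cT) cfun1E.
rewrite cycle_id expr1 => /eqP; rewrite eq_sym -addr_eq0.
by rewrite -(natrD _ 1 1) pnatr_eq0.
Qed.

Lemma cfdot_ind_sgn_sgn : '['Ind[[set: 'S_n]] ('Res[H] sgn), sgn] = 1.
Proof.
by rewrite -cfdot_Res_r irrWnorm // lin_char_irr ?cfRes_lin_char ?cfRepr_sgn_lin.
Qed.

End SignInduced.

Theorem theorem5p2 (m : nat) (hm : (1 <= m)%N)
    (c : 'S_(2 * m)) (hc : cycle_type c = [:: (2 * m)%N]) :
  let rho := ind_repr (subsetT <[c]>)
               (subg_repr (sgn_repr algC (2 * m)) (subsetT <[c]>)) in
  [/\ - ((2 * m)`!)%:R *: omega_cfun (2 * m) = cfRepr rho,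
      rdegree rho = (2 * m - 1)`!,
      (2 <= m)%N -> ~ mx_irreducible rho,
      irr_multiplicity rho (triv_repr algC [set: 'S_(2 * m)]) = 0%N
    & irr_multiplicity rho (sgn_repr algC (2 * m)) = 1%N].
Proof.
move=> rho; have n_gt0 : (0 < 2 * m)%N by rewrite muln_gt0.
have n_even : ~~ odd (2 * m) by rewrite oddM.
have rhoE : cfRepr rho
    = 'Ind[[set: 'S_(2 * m)]] ('Res[<[c]>] (cfRepr (sgn_repr algC (2 * m)))).
  by rewrite cfRepr_ind cfRepr_sub.
have degE : rdegree rho = (2 * m - 1)`!.
  have := congr1 (fun phi : 'CF(_) => phi 1%g) rhoE.
  rewrite cfRepr1 cfInd1 ?subsetT // cfRes1 cfRepr1 mulr1 => /eqP.
  rewrite eqr_nat => /eqP->; apply/eqP.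
  have oc : #|<[c]>%g| = (2 * m)%N by rewrite -orderE (order_full_cycle _) card_ord.
  rewrite -(eqn_pmul2l n_gt0) -{1}oc Lagrange ?subsetT // cardsT card_Sn.
  by case: (2 * m)%N n_gt0 => // k _; rewrite factS subn1.
have sgn_irr : mx_irreducible (sgn_repr algC (2 * m)).
  by apply/mx_abs_irrW/linear_mx_abs_irr.
split=> //.
- by rewrite rhoE (omega_ind_sgn n_gt0 n_even hc).
- move=> m_gt1 rho_irr.
  have /irrP[i Ei] : cfRepr rho \in irr [set: 'S_(2 * m)].
    by apply/irr_reprP; exists rho.
  have /irrP[j Ej] := lin_char_irr (cfRepr_sgn_lin (2 * m)).
  have := cfdot_ind_sgn_sgn c; rewrite -rhoE Ei Ej cfdot_irr.
  case: eqP => [eq_ij _ | _ /eqP]; last by rewrite eq_sym oner_eq0.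
  have /eqP : cfRepr rho 1%g = cfRepr (sgn_repr algC (2 * m)) 1%g.
    by rewrite Ei Ej eq_ij.
  rewrite !cfRepr1 eqr_nat degE.
  rewrite gtn_eqF //; apply: leq_trans (fact_geq _).
  by rewrite leq_subRL // (leq_trans _ (leq_mul (leqnn 2) m_gt1)).
- apply/eqP; rewrite -eqC_nat irr_multiplicityE.
    by rewrite cfRepr_triv rhoE (cfdot_ind_sgn_triv n_even hc).
  by apply/mx_abs_irrW/linear_mx_abs_irr.
by apply/eqP; rewrite -eqC_nat irr_multiplicityE // rhoE cfdot_ind_sgn_sgn.
Qed.
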